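(* There exists a non-factorial language $L$ (over a finite alphabet) of complexity $p_L(n)=O(\log n)$ (and hence with cost $c(L)=0$) such that $d_0(L)=+\infty$.
   Context: A language is a set of finite words over a finite nonempty alphabet; it is factorial if it contains every factor (block of consecutive letters, including the empty word) of each of its words, and non-factorial otherwise. $p_L(n)$ is the number of words of length $n$ in $L$. $S^k$ denotes the set of all concatenations of $k$ elements of $S$. For real $\alpha\ge 0$, $\mathcal{L}(\alpha)$ is the collection of languages $S$ over some finite nonempty alphabet with $p_S(n)=O(n^\alpha)$. Define $d_\alpha(L)=\inf\{k\ge 1 : L\subseteq S^k \text{ for some } S\in\mathcal{L}(\alpha)\}$ and the cost $c(L)=\inf\{\alpha\in[0,+\infty) : d_\alpha(L)<+\infty\}$, with $\inf\emptyset=+\infty$. *)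

(* Defs.v *)
From mathcomp Require Import all_boot all_order all_algebra finmap.
From mathcomp Require Import all_classical all_reals all_analysis.
Import Order.TTheory GRing.Theory Num.Theory.
Import numFieldNormedType.Exports.

Set Implicit Arguments.
Unset Strict Implicit.
Unset Printing Implicit Defensive.

Local Open Scope classical_set_scope.
Local Open Scope ring_scope.

(* Letters are drawn from the fixed countable universe nat, so that languages
   over different finite alphabets can be compared as sets of words. *)
Record language := Language {
  alphabet : {fset nat};
  words : set (seq nat);
  alphabet_neq0 : alphabet != fset0;
  words_alphabet : forall w, words w -> {subset w <= alphabet} }.

Definition factorial_language (L : language) : Prop :=
  forall u w : seq nat, words L w -> infix u w -> words L u.

Definition words_of_length (L : language) (n : nat) : set (seq nat) :=
  [set w | words L w /\ size w = n].

(* fset_set is fset0 on infinite sets: this shows that the junk case never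
   occurs in the definition of complexity below. *)
Lemma finite_words_of_length (L : language) (n : nat) :
  finite_set (words_of_length L n).
Proof.
pose f (t : n.-tuple (alphabet L)) : seq nat := [seq val a | a <- t].
apply: (@sub_finite_set _ _ (f @` setT)); last first.
  by apply: finite_image; exact: finite_finset.
move=> w [Lw sw].
have sub := @words_alphabet L w Lw.
have sz : size (pmap (insub : nat -> option (alphabet L)) w) == n.
  rewrite size_pmap_sub -sw -all_count.
  by apply/allP => a /sub.
exists (Tuple sz) => //=.
rewrite /f /= (pmap_filter (@insubK _ _ _)); apply/all_filterP/allP => a /sub aA.
by rewrite insubT.
Qed.

Definition complexity (L : language) (n : nat) : nat :=
  #|` fset_set (words_of_length L n)|.

Definition lang_power (S : set (seq nat)) (k : nat) : set (seq nat) :=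
  [set w | exists ws : k.-tuple (seq nat),
    (forall i, S (tnth ws i)) /\ w = flatten ws].

Definition poly_languages (R : realType) (alpha : R) : set language :=
  [set S : language |
    (fun n => (complexity S n)%:R : R) =O_\oo (fun n => n%:R `^ alpha)].

Definition d_alpha (R : realType) (alpha : R) (L : language) : \bar R :=
  ereal_inf [set k%:R%:E | k in [set k : nat | (1 <= k)%N /\
    exists2 S : language, poly_languages alpha S & words L `<=` lang_power (words S) k]].

Definition cost (R : realType) (L : language) : \bar R :=
  ereal_inf [set alpha%:E | alpha in [set alpha : R | 0 <= alpha /\
    (d_alpha alpha L < +oo)%E]].

(* Main.v *)
Require Import Defs.
From mathcomp Require Import all_boot all_order all_algebra finmap.
From mathcomp Require Import all_classical all_reals all_analysis.
From mathcomp Require Import zify.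
Import Order.TTheory GRing.Theory Num.Theory.
Import numFieldNormedType.Exports.

(** The language consists of the prefixes of length s^2 + r of the periodic
    words (0^s 1^r 2^j 3)^omega, where r < s and j < log_2 s. Three properties
    make it work.

    - It is sparse: as r < s, the length s^2 + r determines s and r, so that at
      most log_2 s words have that length ([complexity_periodic_language]).

    - Its words are rigid: the period has length O(s) while the word has length
      at least s^2, so that for a fixed k any factor of length at least
      s^2 / k contains, once s is large, a complete block between two
      occurrences of 3, and thereby determines (s, r, j)
      ([first_code_periodic_word]).

    - It is rich: as s ranges over [M, 2M), r below M and j below l <= log_2 M,
      one gets M^2 l words, all of length less than 4 M^2.

    Suppose that all of them are concatenations of k words of a language S with
    at most C words of each length. Each has a piece of length at least
    its own length over k, and by rigidity these pieces are pairwise distinct.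
    So S has at least M^2 l words of length less than 4 M^2, whereas it has at
    most 4 M^2 C of them. Taking l > 4 C is a contradiction
    ([periodic_language_not_covered]), hence d_0 is infinite. The cost
    vanishes because log n = O(n^alpha) for every alpha > 0, so that the
    language covers itself with k = 1. *)

Local Open Scope classical_set_scope.
Local Open Scope nat_scope.

(** * Periodic words and their long factors *)

Definition code (s r j : nat) : seq nat := nseq s 0 ++ nseq r 1 ++ nseq j 2.

(** Since [rcons (code s r j) 3] is nonempty, s ^ 2 + r copies of it are enough
    to cut a prefix of length s ^ 2 + r. *)
Definition periodic_word (s r j : nat) : seq nat :=
  take (s ^ 2 + r) (flatten (nseq (s ^ 2 + r) (rcons (code s r j) 3))).

(** Recovers the repeated block from any sufficiently long factor of a periodic
    word, independently of where the factor starts. *)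
Definition first_code (v : seq nat) : seq nat :=
  let t := drop (index 3 v).+1 v in take (index 3 t) t.

Lemma size_code s r j : size (code s r j) = s + r + j.
Proof. by rewrite !size_cat !size_nseq addnA. Qed.

Lemma delimiter_notin_code s r j : 3 \notin code s r j.
Proof. by rewrite !mem_cat !mem_nseq !andbF. Qed.

(** The exponents are read off by counting each letter. *)
Lemma code_inj s r j s' r' j' :
  code s r j = code s' r' j' -> [/\ s = s', r = r' & j = j'].
Proof.
move=> e; have cnt a : count_mem a (code s r j) = count_mem a (code s' r' j').
  by rewrite e.
move: (cnt 0) (cnt 1) (cnt 2); rewrite !count_cat !count_nseq /=.
by rewrite !(mul0n, mul1n, addn0, add0n) => -> -> ->.
Qed.

Lemma size_flatten_nseq (T : Type) m (B : seq T) :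
  size (flatten (nseq m B)) = m * size B.
Proof. by elim: m => //= m IH; rewrite size_cat IH mulSn. Qed.

Lemma size_periodic_word s r j : size (periodic_word s r j) = s ^ 2 + r.
Proof.
apply/size_takel; rewrite size_flatten_nseq size_rcons mulnS.
exact: leq_addr.
Qed.

Lemma first_code_cat (x c y : seq nat) : 3 \notin x -> 3 \notin c ->
  first_code (x ++ 3 :: c ++ 3 :: y) = c.
Proof.
move=> x3 c3; rewrite /first_code index_cat (negbTE x3) /= addn0.
have -> : drop (size x).+1 (x ++ 3 :: c ++ 3 :: y) = c ++ 3 :: y.
  by rewrite -cat_rcons -(size_rcons x 3) drop_size_cat.
by rewrite index_cat (negbTE c3) /= addn0 take_size_cat.
Qed.

(** A window of two periods starts with a possibly empty suffix [x] of a block, followed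
    by a delimiter, a complete block and another delimiter, whatever its
    position. *)
Lemma first_code_factor (c v p q : seq nat) m : 3 \notin c ->
  2 * (size c).+1 <= size v ->
  p ++ v ++ q = flatten (nseq m (rcons c 3)) -> first_code v = c.
Proof.
move=> c3 sv; elim: m p => [|m IH] p e.
  by have /= := congr1 size e; rewrite !size_cat; lia.
(* Whole periods before the window are discarded by the induction. *)
have [lep|ltp] := leqP (size c).+1 (size p).
  apply: (IH (drop (size c).+1 p)).
  move: e; rewrite -{1}(cat_take_drop (size c).+1 p) -catA.
  move/(congr1 (drop (size c).+1)); rewrite drop_size_cat ?size_takel //=.
  by rewrite drop_size_cat ?size_rcons.
set x := drop (size p) c.
have evq : v ++ q = x ++ 3 :: flatten (nseq m (rcons c 3)).
  have /= := congr1 (drop (size p)) e.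
  by rewrite drop_size_cat // drop_cat size_rcons ltp drop_rcons // cat_rcons.
have x3 : 3 \notin x by apply: contra c3; exact: mem_drop.
have sx : size x <= size c by rewrite size_drop leq_subr.
case: m {IH e} evq => [|m] evq.
  by have /= := congr1 size evq; rewrite !size_cat /=; lia.
have {}evq : v ++ q = (x ++ 3 :: rcons c 3) ++ flatten (nseq m (rcons c 3)).
  by rewrite evq /= -catA /=.
set u := x ++ 3 :: rcons c 3 in evq.
have uE y : x ++ 3 :: c ++ 3 :: y = u ++ y by rewrite /u -catA /= cat_rcons.
have su : size u <= size v by rewrite size_cat /= size_rcons; lia.
have -> : v = x ++ 3 :: c ++ 3 :: drop (size u) v; last exact: first_code_cat.
rewrite uE -{1}(cat_take_drop (size u) v); congr (_ ++ _).
by rewrite -(takel_cat q su) evq take_size_cat.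
Qed.

(** Rigidity: two words of the language with different parameters share no
    factor that covers two periods of each. *)
Lemma first_code_periodic_word s r j v :
  infix v (periodic_word s r j) -> 2 * (s + r + j).+1 <= size v ->
  first_code v = code s r j.
Proof.
move=> /infixP[p [q e]]; rewrite -size_code => sv.
pose w := flatten (nseq (s ^ 2 + r) (rcons (code s r j) 3)).
apply: (@first_code_factor _ _ p (q ++ drop (s ^ 2 + r) w) (s ^ 2 + r)) => //.
  exact: delimiter_notin_code.
by rewrite -[RHS](cat_take_drop (s ^ 2 + r)) [take _ _]e -!catA.
Qed.

(** * The language *)

(** The intervals [s^2, s^2 + s) are pairwise disjoint. *)
Lemma sqr_add_inj s r s' r' : r < s -> r' < s' ->
  s ^ 2 + r = s' ^ 2 + r' -> s = s' /\ r = r'.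
Proof.
move=> rs rs' e; suff ss' : s = s' by split=> //; move: e; rewrite ss'; lia.
by apply/eqP; rewrite eqn_leq; apply/andP; split; rewrite leqNgt; apply/negP; nia.
Qed.

Definition periodic_words : set (seq nat) := [set w | exists s r j,
  [/\ r < s, j < trunc_log 2 s & w = periodic_word s r j]].

Lemma periodic_words_alphabet w :
  periodic_words w -> {subset w <= [fset 0; 1; 2; 3]%fset}.
Proof.
move=> [s [r [j [_ _ ->]]]] a /mem_take /flattenP[c].
rewrite mem_nseq => /andP[_ /eqP ->].
rewrite mem_rcons inE !mem_cat !mem_nseq !inE.
by move=> /or4P[|/andP[_]|/andP[_]|/andP[_]] ->; rewrite ?orbT.
Qed.

Lemma alphabet4_neq0 : [fset 0; 1; 2; 3]%fset != fset0.
Proof. by apply/fset0Pn; exists 0; rewrite !inE. Qed.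

Definition periodic_language : language :=
  Language alphabet4_neq0 periodic_words_alphabet.

(** All words of the language are nonempty. *)
Lemma periodic_language_nonfactorial : ~ factorial_language periodic_language.
Proof.
move=> /(_ [::] (periodic_word 2 0 0)) [].
- by exists 2, 0, 0.
- exact: infix0s.
- move=> s [r [j [rs _ /(congr1 size)]]]; rewrite size_periodic_word.
  by case: s rs.
Qed.

(** Only the parameter [j] is free among the words of a given length. *)
Lemma complexity_periodic_language n : complexity periodic_language n <= trunc_log 2 n.
Proof.
apply: geq_card_fset_set.
have [[s [r [rs ->]]]|no] := pselect (exists s r, r < s /\ n = s ^ 2 + r).
  apply: card_le_trans (card_image_le (periodic_word s r) _).
  apply: subset_card_le => w [[s' [r' [j [rs' jl ->]]]]].
  rewrite size_periodic_word => /(sqr_add_inj _ _ _ _ rs' rs)[<- <-].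
  exists j => //=; apply: leq_trans jl _.
  by apply: leq_trunc_log; nia.
suff -> : words_of_length periodic_language n = set0 by rewrite card_ge0.
apply/seteqP; split=> // w [[s [r [j [rs _ ->]]]]].
by rewrite size_periodic_word => e; case: no; exists s, r.
Qed.

(** * Covers by languages of bounded complexity *)

Lemma exists_long_piece (T : Type) k b (ws : k.-tuple (seq T)) : 0 < k ->
  k * b <= size (flatten ws) -> exists i, b <= size (tnth ws i).
Proof.
move=> k0 h; apply: contrapT => no.
have lt i : size (tnth ws i) < b by rewrite ltnNge; apply/negP => ?; apply: no; exists i.
have : size (flatten ws) < k * b; last by rewrite ltnNge h.
rewrite size_flatten sumnE big_map big_tuple.
case: b {h no} lt => [/(_ (Ordinal k0))//|b] lt.
apply: (@leq_ltn_trans (k * b)).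
  rewrite -[k in k * b]card_ord -sum_nat_const; apply: leq_sum => i _; exact: lt.
by rewrite ltn_pmul2l.
Qed.

Lemma tnth_infix (T : eqType) k (ws : k.-tuple (seq T)) i :
  infix (tnth ws i) (flatten ws).
Proof.
have /path.splitPr[s1 s2] := mem_tnth i ws.
by rewrite flatten_cat /= infix_infix.
Qed.

Lemma size_le_complexity (S : language) (C n : nat) (l : seq (seq nat)) :
  (forall m, complexity S m <= C) -> uniq l ->
  (forall v, v \in l -> words S v /\ size v < n) -> size l <= n * C.
Proof.
move=> SC ul lS.
pose F := flatten [seq finmap.enum_fset (fset_set (words_of_length S m)) | m <- iota 0 n].
apply: (@leq_trans (size F)).
  apply: uniq_leq_size => // v /lS[Sv vn]; apply/flattenP.
  exists (finmap.enum_fset (fset_set (words_of_length S (size v)))).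
    by apply/mapP; exists (size v) => //; rewrite mem_iota.
  by rewrite in_fset_set ?inE //; exact: finite_words_of_length.
rewrite size_flatten sumnE /shape -map_comp big_map.
rewrite -[n in n * C](size_iota 0) -sum1_size big_distrl /=.
by apply: leq_sum => m _; rewrite mul1n; exact: SC.
Qed.

(** The pigeonhole argument: long pieces of distinct words are distinct, and
    there are more words than available pieces. *)
Lemma periodic_language_not_covered (S : language) (C k : nat) : 0 < k ->
  (forall m, complexity S m <= C) ->
  ~ (words periodic_language `<=` lang_power (words S) k).
Proof.
move=> k0 SC cov.
(* The factor 2 ^ l ensures l <= log_2 M. The factor 8 k ensures that a k-th of
   a word, of length at least M ^ 2 / k >= 8 M, contains two periods, each of
   length at most 4 M. *)
pose l := (4 * C).+1; pose M := 8 * k * 2 ^ l.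
have l2 : l < 2 ^ l by exact: ltn_expl.
have Mk : 8 * k <= M by rewrite leq_pmulr // expn_gt0.
have lM : l < M by rewrite /M; nia.
have piece (t : 'I_M * 'I_M * 'I_l) : exists v, [/\ words S v, size v < 4 * M ^ 2
    & first_code v = code (M + t.1.1) t.1.2 t.2].
  case: t => [[a r] j] /=.
  have [ws [Sws e]] : lang_power (words S) k (periodic_word (M + a) r j).
    apply: cov; exists (M + a), r, j; split=> //.
      by apply: leq_trans (ltn_ord r) _; exact: leq_addr.
    apply: leq_trans (ltn_ord j) _; apply: trunc_log_max => //.
    by rewrite /M; nia.
  have sw := size_periodic_word (M + a) r j.
  have [] := @exists_long_piece _ k (8 * M) ws k0.
    by rewrite -e sw; nia.
  move=> i long; have inf := tnth_infix _ _ ws i; rewrite -e in inf.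
  exists (tnth ws i); split=> //.
    apply: leq_ltn_trans (size_infix inf) _; rewrite sw.
    by have := ltn_ord a; have := ltn_ord r; nia.
  apply: first_code_periodic_word => //; apply: leq_trans long.
  by have := ltn_ord a; have := ltn_ord r; have := ltn_ord j; lia.
have [f fP] := choice piece.
have f_inj : injective f.
  move=> [[a r] j] [[a' r'] j'] e.
  have [_ _ c] := fP (a, r, j); have [_ _ c'] := fP (a', r', j').
  move: c; rewrite e c' /= => /code_inj[/addnI/val_inj -> /val_inj -> /val_inj ->] //.
have f_uniq : uniq [seq f t | t : 'I_M * 'I_M * 'I_l].
  by rewrite map_inj_uniq // enum_uniq.
have := size_le_complexity S C (4 * M ^ 2) _ SC f_uniq.
rewrite size_map -cardE !card_prod !card_ord => le.
suff : M * M * l <= 4 * M ^ 2 * C by rewrite /l; nia.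
by apply: le => v /mapP[t _ ->]; have [] := fP t.
Qed.

Local Close Scope nat_scope.
Local Open Scope ring_scope.

(** * Asymptotic estimates *)

Lemma trunc_log_le_ln (R : realType) (n : nat) : (0 < n)%N ->
  (trunc_log 2 n)%:R * ln 2 <= ln (n%:R : R).
Proof.
move=> n0; rewrite mulr_natl -lnXn //.
rewrite ler_ln ?posrE ?exprn_gt0 ?ltr0n //.
by rewrite -natrX ler_nat trunc_logP.
Qed.

Lemma complexity_periodic_language_ln (R : realType) :
  (fun n => (complexity periodic_language n)%:R : R) =O_\oo
    (fun n => ln (n%:R : R)).
Proof.
have ln2 : 0 < ln 2 :> R by rewrite ln_gt0 // ltr1n.
apply/eqO_exP; exists (ln 2)^-1; first by rewrite invr_gt0.
near=> n; have n0 : (0 < n)%N by near: n; exact: nbhs_infty_gt.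
rewrite ger0_norm // ger0_norm ?ln_ge0 ?ler1n // mulrC ler_pdivlMr //.
apply: le_trans (trunc_log_le_ln R n n0).
by rewrite ler_pM2r // ler_nat complexity_periodic_language.
Unshelve. all: by end_near. Qed.

(** Apply ln x < x to x = n ^ alpha. *)
Lemma ln_bigO_powR (R : realType) (alpha : R) : 0 < alpha ->
  (fun n => ln (n%:R : R)) =O_\oo (fun n => n%:R `^ alpha).
Proof.
move=> a0; apply/eqO_exP; exists alpha^-1; first by rewrite invr_gt0.
near=> n; have n0 : (0 < n)%N by near: n; exact: nbhs_infty_gt.
rewrite ger0_norm ?ln_ge0 ?ler1n // ger0_norm ?powR_ge0 // mulrC ler_pdivlMr //.
by rewrite mulrC -ln_powR ltW // ln_sublinear // powR_gt0 // ltr0n.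
Unshelve. all: by end_near. Qed.

(** A language of the right growth covers itself with one factor. *)
Lemma d_alpha_le1 (R : realType) (alpha : R) (K : language) :
  poly_languages alpha K -> (d_alpha alpha K <= 1)%E.
Proof.
move=> Ka; apply: ereal_inf_lbound; exists 1%N => //; split=> //; exists K => // w Kw.
by exists [tuple w]; split; [move=> i; rewrite (tnth_nth w) ord1|rewrite /= cats0].
Qed.

(** As complexities are finite numbers, a bound valid from some rank on extends
    to all lengths. *)
Lemma complexity_bounded (R : realType) (S : language) :
  poly_languages (0 : R) S -> exists C, forall n, (complexity S n <= C)%N.
Proof.
move=> /eqO_exP[c c0 [N _ cN]].
exists (maxn (\max_(i < N) complexity S i) (Num.truncn c)) => n.
rewrite leq_max; have [nN|Nn] := ltnP n N.
  by rewrite (leq_bigmax (Ordinal nN)).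
apply/orP; right; rewrite truncn_ge_nat; last exact: ltW.
by have := cN n Nn; rewrite /= powRr0 normr1 mulr1 normr_nat.
Qed.

Theorem theorem7p1 (R : realType) :
  exists L : language,
    [/\ ~ factorial_language L,
        (fun n => (complexity L n)%:R : R) =O_\oo (fun n => ln (n%:R : R)),
        cost R L = 0%E
      & d_alpha (0 : R) L = +oo%E].
Proof.
exists periodic_language; split.
- exact: periodic_language_nonfactorial.
- exact: complexity_periodic_language_ln.
- apply/eqP; rewrite eq_le; apply/andP; split; last first.
    by apply: le_ereal_inf_tmp => _ [a [a0 _] <-]; rewrite lee_fin.
  apply/lee_addgt0Pr => e e0; rewrite add0e; apply: ereal_inf_lbound.
  exists e => //; split; first exact: ltW.
  apply: le_lt_trans (ltry 1); apply: d_alpha_le1; rewrite /poly_languages /=.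
  exact: eqO_trans (complexity_periodic_language_ln R) (ln_bigO_powR R e e0).
- rewrite /d_alpha [X in ereal_inf X](_ : _ = set0) ?ereal_inf0 //.
  apply/seteqP; split=> // x [k [k0 [S Sb cov]] _].
  have [C SC] := complexity_bounded R S Sb.
  exact: (periodic_language_not_covered S C k k0 SC cov).
Qed.
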